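(* Let $N\ge 2$, let $\mathcal{G}^0=(\mathcal{V},\mathcal{E}^0)$ be an undirected graph without self-loops on $\mathcal{V}=\{1,\dots,N\}$ with $m=|\mathcal{E}^0|$ edges, let $A^d,A^c\in\mathbb{R}^{n_x\times n_x}$, and let $0\le\rho_l\le\rho_u\le 1$. Consider the Markov jump linear system $x_{k+1}=A_{\sigma_k}x_k$ with $A_i=I_N\otimes A^d+L(\mathcal{G}_i)\otimes A^c$, $i\in\mathcal{K}=\{1,\dots,2^m\}$. Let $$\bm{\Delta}=\left\{\begin{bmatrix}a&0\\ b&0\\ 0&a\end{bmatrix}\ :\ a,b\ge 0,\ a^2\in[\rho_l,\rho_u],\ b^2=1-a^2\right\}.$$ Suppose there exist a symmetric matrix $\tilde X\in\mathbb{R}^{n_x\times n_x}$ with $\tilde X\succ0$ and a symmetric matrix $P\in\mathbb{R}^{5n_x\times 5n_x}$ with $$\begin{bmatrix}\Delta\otimes I_{n_x}\\ I_{2n_x}\end{bmatrix}^\top P\begin{bmatrix}\Delta\otimes I_{n_x}\\ I_{2n_x}\end{bmatrix}\succ0\quad\text{for all }\Delta\in\bm{\Delta}$$ such that $$A^{d\top}\tilde XA^d-\tilde X\prec0$$ and, for each $\lambda\in\{\lambda_2,\lambda_N\}$, $$\Psi_\lambda^\top\begin{bmatrix}-\tilde X&0&0&0\\ 0&\tilde X&0&0\\ 0&0&2\tilde X&0\\ 0&0&0&P\end{bmatrix}\Psi_\lambda\prec0,\qquad \Psi_\lambda=\begin{bmatrix}I_{n_x}&0\\ A^d&\sqrt{\lambda}\,\mathcal{I}_1\\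 0&\mathcal{I}_2\\ 0&I_{3n_x}\\ 0&\mathcal{I}_3\\ \sqrt{\lambda}A^c&0\end{bmatrix}\in\mathbb{R}^{8n_x\times4n_x},$$ where $\lambda_2$ and $\lambda_N$ are the smallest and largest non-zero eigenvalues of $L(\mathcal{G}^0)$, respectively, and $\mathcal{I}_j\in\mathbb{R}^{n_x\times3n_x}$ is the $j$th block-row of $I_3\otimes I_{n_x}$. Then the Markov jump linear system is robustly mean-square stable for all $\Gamma\in\operatorname{conv}\hat{\bm{\Gamma}}_m$.
   Context: Graphs and modes: an edge $e^{ij}=e^{ji}=\{i,j\}$ is an unordered pair of distinct vertices. The Laplacian $L(\mathcal{G})=[l_{ij}(\mathcal{G})]$ of a graph $\mathcal{G}$ with edge set $\mathcal{E}$ has $l_{ij}=-1$ if $i\ne j$ and $\{i,j\}\in\mathcal{E}$, $l_{ij}=0$ if $i\neq j$ and $\{i,j\}\notin\mathcal{E}$, and $l_{ii}=-\sum_{l\ne i}l_{il}$. Fix a bijection $\nu:\mathcal{E}^0\to\{1,\dots,m\}$. Each edge $e\in\mathcal{E}^0$ carries a process $\theta_k(e)\in\{0,1\}$ ($1$ = packet transmitted, $0$ = packet lost), and the mode is $\sigma_k=1+\sum_{e\in\mathcal{E}^0}\theta_k(e)2^{m-\nu(e)}\in\mathcal{K}=\{1,\dots,2^m\}$. For $i\in\mathcal{K}$, $\mathcal{G}_i=(\mathcal{V},\mathcal{E}_i)$, where $\mathcal{E}_i\subseteq\mathcal{E}^0$ is the set of edges with $\theta(e)=1$ in mode $i$.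 The process $\{\sigma_k\}$ is a homogeneous Markov chain with transition probability matrix $\Gamma=[t_{ij}]\in\mathbb{R}^{2^m\times2^m}$, $\mathbb{P}(\sigma_{k+1}=j\mid\sigma_k=i)=t_{ij}$. Stability: the system $x_{k+1}=A_{\sigma_k}x_k$ is robustly mean-square stable for all $\Gamma$ in a set $\bm{\Gamma}$ of row-stochastic $2^m\times 2^m$ matrices if $\lim_{k\to\infty}\mathbb{E}[x_k]=0$ and $\lim_{k\to\infty}\mathbb{E}[\|x_k\|^2]=0$ for all $x_0\in\mathbb{R}^{Nn_x}$, $\sigma_0\in\mathcal{K}$ and $\Gamma\in\bm{\Gamma}$. Uncertainty set: for $p\in\mathcal{P}_m=[0,1]^m$ let $$f(p)=\begin{bmatrix}1-p_1\\ p_1\end{bmatrix}\otimes\begin{bmatrix}1-p_2\\ p_2\end{bmatrix}\otimes\cdots\otimes\begin{bmatrix}1-p_m\\ p_m\end{bmatrix}\in\mathbb{R}^{2^m},$$ $\hat{\bm{t}}_m=\{f(p): p\in\mathcal{P}_m,\ p_i\in\{\rho_l,\rho_u\}\text{ for all }i\}$ and $\hat{\bm{\Gamma}}_m=\{[t_1\ t_2\ \cdots\ t_{2^m}]^\top : t_i\in\hat{\bm{t}}_m\text{ for all } i\}$, i.e. the set of $2^m\times2^m$ matrices all of whose rows are (transposes of) elements of $\hat{\bm{t}}_m$. $\operatorname{conv}$ denotes the convex hull, $\otimes$ the Kronecker product, and $M\succ0$ ($M\prec0$) means $M$ is symmetric positive (negative) definite. *)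

(* Defs.v *)
(* MathComp / MathComp-Analysis; the real numbers are an arbitrary R : realType. *)
From HB Require Import structures.
From mathcomp Require Import all_boot all_order all_algebra.
From mathcomp Require Export mxtens.
From mathcomp Require Import all_classical all_reals all_analysis.
Import Order.TTheory GRing.Theory Num.Theory.
Import numFieldNormedType.Exports.

Set Implicit Arguments.
Unset Strict Implicit.
Unset Printing Implicit Defensive.

Local Open Scope classical_set_scope.
Local Open Scope ring_scope.

(* mxtens declares this notation inside a section only *)
Notation "A *t B" := (tensmx A B)
  (at level 40, left associativity, format "A  *t  B") : ring_scope.

Definition posdef (R : realType) n (M : 'M[R]_n) : Prop :=
  M^T = M /\ forall x : 'cV[R]_n, x != 0 -> 0 < (x^T *m M *m x) ord0 ord0.

Definition negdef (R : realType) n (M : 'M[R]_n) : Prop :=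
  M^T = M /\ forall x : 'cV[R]_n, x != 0 -> (x^T *m M *m x) ord0 ord0 < 0.

Definition sqr_norm2 (R : realType) n (x : 'cV[R]_n) : R :=
  \sum_(i < n) x i ord0 ^+ 2.

Definition conv_hull (R : realType) (V : lmodType R) (S : set V) : set V :=
  smallest (@convex_set R V) S.

(** Graphs: an edge set on the vertices 'I_N is a set of two-element subsets. *)

Definition simple_graph N (E : {set {set 'I_N}}) : Prop :=
  forall e, e \in E -> #|e| = 2%N.

Definition laplacian_offdiag (R : realType) N (E : {set {set 'I_N}})
    (i j : 'I_N) : R :=
  if [set i; j]%SET \in E then -1 else 0.

Definition laplacian (R : realType) N (E : {set {set 'I_N}}) : 'M[R]_N :=
  \matrix_(i, j) if i == j then - \sum_(l | l != i) laplacian_offdiag R E i l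
                 else laplacian_offdiag R E i j.

Definition nonzero_eigenvalue (R : realType) n (M : 'M[R]_n) (a : R) : Prop :=
  eigenvalue M a /\ a != 0.

Definition smallest_nonzero_eigenvalue (R : realType) n (M : 'M[R]_n) (a : R) :=
  nonzero_eigenvalue M a /\ forall b, nonzero_eigenvalue M b -> a <= b.

Definition largest_nonzero_eigenvalue (R : realType) n (M : 'M[R]_n) (a : R) :=
  nonzero_eigenvalue M a /\ forall b, nonzero_eigenvalue M b -> b <= a.

(** Modes.  Modes, edge numbers and vertices are counted from 0: the mode
    i : 'I_(2 ^ m) is the (i + 1)-st one, and nu e + 1 is the number of e. *)

Definition edge_of N (E0 : {set {set 'I_N}}) := {e : {set 'I_N} | e \in E0}.

Definition mode_number N (E0 : {set {set 'I_N}}) m (nu : edge_of E0 -> 'I_m)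
    (theta : {ffun edge_of E0 -> bool}) : nat :=
  (\sum_(e : edge_of E0) theta e * 2 ^ (m - (nu e).+1))%N.

Definition mode_edges N (E0 : {set {set 'I_N}}) m (nu : edge_of E0 -> 'I_m)
    (i : 'I_(2 ^ m)) : {set {set 'I_N}} :=
  [set val e | e : edge_of E0 &
     [exists theta, (mode_number nu theta == i) && theta e]]%SET.

Definition mode_matrix (R : realType) N (E0 : {set {set 'I_N}}) m
    (nu : edge_of E0 -> 'I_m) n (Ad Ac : 'M[R]_n) (i : 'I_(2 ^ m)) :
    'M[R]_(N * n) :=
  1%:M *t Ad + laplacian R (mode_edges nu i) *t Ac.

(** Markov jump linear systems with s modes *)

(* only meaningful when Pr B != 0 *)
Definition cond_prob (d : measure_display) (T : measurableType d)
    (R : realType) (Pr : probability T R) (A B : set T) : R :=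
  fine (Pr (A `&` B)) / fine (Pr B).

Definition history T s (sigma : nat -> T -> 'I_s) (k : nat)
    (h : nat -> 'I_s) : set T :=
  [set w | forall l, (l <= k)%N -> sigma l w = h l].

Definition homogeneous_markov_chain (d : measure_display)
    (T : measurableType d) (R : realType) (Pr : probability T R) s
    (Gamma : 'M[R]_s) (sigma : nat -> T -> 'I_s) : Prop :=
  (forall k i, measurable [set w | sigma k w = i]) /\
  forall k (h : nat -> 'I_s) (j : 'I_s),
    Pr (history sigma k h) != 0%E ->
    cond_prob Pr [set w | sigma k.+1 w = j] (history sigma k h) = Gamma (h k) j.

Fixpoint trajectory (R : realType) T s n (A : 'I_s -> 'M[R]_n)
    (sigma : nat -> T -> 'I_s) (x0 : 'cV[R]_n) (k : nat) (w : T) : 'cV[R]_n :=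
  if k is k'.+1 then A (sigma k' w) *m trajectory A sigma x0 k' w else x0.

Definition robustly_mean_square_stable (R : realType) s n
    (A : 'I_s -> 'M[R]_n) (GammaSet : set 'M[R]_s) : Prop :=
  forall (x0 : 'cV[R]_n) (s0 : 'I_s) (Gamma : 'M[R]_s), GammaSet Gamma ->
  forall (d : measure_display) (T : measurableType d) (Pr : probability T R)
    (sigma : nat -> T -> 'I_s),
    homogeneous_markov_chain Pr Gamma sigma ->
    Pr [set w | sigma 0%N w = s0] = 1%E ->
    (forall i : 'I_n,
       ('E_Pr[fun w => trajectory A sigma x0 k w i ord0])%E @[k --> \oo]
         --> 0%E) /\
    ('E_Pr[fun w => sqr_norm2 (trajectory A sigma x0 k w)])%E @[k --> \oo]
      --> 0%E.

(** Uncertainty set of transition probability matrices *)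

Definition bernoulli_col (R : realType) (q : R) : 'cV[R]_2 :=
  \col_(i < 2) if i == ord0 then 1 - q else q.

Fixpoint edge_distribution (R : realType) m : ('I_m -> R) -> 'cV[R]_(2 ^ m) :=
  match m return ('I_m -> R) -> 'cV[R]_(2 ^ m) with
  | 0 => fun _ => const_mx 1
  | m'.+1 => fun p =>
      castmx (esym (expnS 2 m'), muln1 1)
        (bernoulli_col (p ord0) *t
         edge_distribution (fun i : 'I_m' => p (lift ord0 i)))
  end.

Definition vertex_distributions (R : realType) (rl ru : R) m :
    set 'cV[R]_(2 ^ m) :=
  [set t | exists2 p : 'I_m -> R,
     forall i, 0 <= p i <= 1 /\ (p i = rl \/ p i = ru)
     & t = edge_distribution p].
Arguments vertex_distributions {R} rl ru m.

Definition vertex_transitions (R : realType) (rl ru : R) m :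
    set 'M[R]_(2 ^ m) :=
  [set G : 'M[R]_(2 ^ m) | forall i,
     vertex_distributions rl ru m (row i G)^T].
Arguments vertex_transitions {R} rl ru m.

(** Matrix inequalities *)

Definition Delta_mx (R : realType) (a b : R) : 'M[R]_(3, 2) :=
  \matrix_(i, j)
    nth 0 (nth [::] [:: [:: a; 0]; [:: b; 0]; [:: 0; a]] i) j.

Definition Delta_set (R : realType) (rl ru : R) : set 'M[R]_(3, 2) :=
  [set D | exists a b, [/\ 0 <= a, 0 <= b, rl <= a ^+ 2 <= ru,
                           b ^+ 2 = 1 - a ^+ 2 & D = Delta_mx a b]].

Lemma dim_3_2 n : (3 * n + 2 * n = 5 * n)%N.
Proof. by rewrite -mulnDl. Qed.

Lemma dim_3_1_1 n : (3 * n + (n + n) = 5 * n)%N.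
Proof. by rewrite addnn -mul2n dim_3_2. Qed.

Definition multiplier_factor (R : realType) n (D : 'M[R]_(3, 2)) :
    'M[R]_(5 * n, 2 * n) :=
  castmx (dim_3_2 n, erefl)
    (col_mx (D *t (1%:M : 'M[R]_n)) (1%:M : 'M[R]_(2 * n))).

Definition block_row_I3 (R : realType) n (j : 'I_3) : 'M[R]_(n, 3 * n) :=
  rowsub (fun i : 'I_n => mxtens_index (j, i))
    ((1%:M : 'M[R]_3) *t (1%:M : 'M[R]_n)).

(* The dimensions n + 3 * n and n + (n + (n + 5 * n)) are convertible to
   4 * n and 8 * n. *)
Definition Psi (R : realType) n (Ad Ac : 'M[R]_n) (lambda : R) :
    'M[R]_(n + (n + (n + 5 * n)), n + 3 * n) :=
  let I1 := block_row_I3 R n (inord 0) in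
  let I2 := block_row_I3 R n (inord 1) in
  let I3 := block_row_I3 R n (inord 2) in
  let sl := Num.sqrt lambda in
  col_mx (row_mx 1%:M 0)
  (col_mx (row_mx Ad (sl *: I1))
  (col_mx (row_mx 0 I2)
  (castmx (dim_3_1_1 n, erefl)
    (col_mx (row_mx 0 1%:M)
    (col_mx (row_mx 0 I3)
            (row_mx (sl *: Ac) 0)))))).

Definition middle_mx (R : realType) n (X : 'M[R]_n) (P : 'M[R]_(5 * n)) :
    'M[R]_(n + (n + (n + 5 * n))) :=
  block_mx (- X) 0 0
    (block_mx X 0 0
      (block_mx (2 *: X) 0 0 P)).

(* Main.v *)
Require Import Defs.
From HB Require Import structures.
From mathcomp Require Import all_boot all_order all_algebra.
From mathcomp Require Import all_classical all_reals all_analysis.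
From mathcomp Require Import ring lra zify.
Unset Printing Implicit Defensive.
Import Order.TTheory GRing.Theory Num.Theory.
Import numFieldNormedType.Exports.
Local Open Scope classical_set_scope.
Local Open Scope ring_scope.

(** Only the largest Laplacian eigenvalue [lambda] is needed.  Write the state
    as an n x N matrix Y and the Laplacian of the nominal graph as
    L = sum_l b_l b_l^T with one incidence vector per edge.  For independent
    Bernoulli bits of parameters p_l, the mean of |Y_{k+1}|^2 in the X-norm is
    |Ad Y + sum_l p_l Ac Y b_l b_l^T|^2 + 2 sum_l p_l (1 - p_l) |Ac Y b_l|^2.
    Instead of diagonalising L, apply the matrix inequality at [lambda] to each
    scaled edge signal Y b_l / sqrt lambda: the cross terms and the variance
    terms then match exactly, and the remaining two discrepancies have the right
    sign because L <= lambda and Ad^T X Ad < X.  This gives a contraction factor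
    uniform in p, which is affine in each row of the transition matrix and hence
    extends to the convex hull. *)

Set Implicit Arguments.
Unset Strict Implicit.

(** * Quadratic forms *)

Section MatrixForms.
Variable R : realType.

(** The trace sums over the columns, so a whole network state, one column per vertex, is measured at
    once; a single column gives the usual bilinear form. *)
Definition mxform n k (M : 'M[R]_n) (Z W : 'M[R]_(n, k)) : R :=
  \tr (Z^T *m M *m W).

Definition mxquad n k (M : 'M[R]_n) (Z : 'M[R]_(n, k)) : R := mxform M Z Z.

Lemma mxformDl n k (M : 'M[R]_n) (Z Z' W : 'M[R]_(n, k)) :
  mxform M (Z + Z') W = mxform M Z W + mxform M Z' W.
Proof. by rewrite /mxform linearD /= !mulmxDl mxtraceD. Qed.

Lemma mxformDr n k (M : 'M[R]_n) (Z W W' : 'M[R]_(n, k)) :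
  mxform M Z (W + W') = mxform M Z W + mxform M Z W'.
Proof. by rewrite /mxform mulmxDr mxtraceD. Qed.

Lemma mxformZl n k (M : 'M[R]_n) a (Z W : 'M[R]_(n, k)) :
  mxform M (a *: Z) W = a * mxform M Z W.
Proof. by rewrite /mxform linearZ /= -!scalemxAl mxtraceZ. Qed.

Lemma mxformZr n k (M : 'M[R]_n) a (Z W : 'M[R]_(n, k)) :
  mxform M Z (a *: W) = a * mxform M Z W.
Proof. by rewrite /mxform -scalemxAr mxtraceZ. Qed.

Lemma mxformC n k (M : 'M[R]_n) (Z W : 'M[R]_(n, k)) :
  M^T = M -> mxform M Z W = mxform M W Z.
Proof. by move=> Ms; rewrite /mxform -mxtrace_tr !trmx_mul Ms trmxK mulmxA. Qed.

Lemma mxform_sumr n k (M : 'M[R]_n) (I : Type) (r : seq I)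
    (Z : 'M[R]_(n, k)) (W : I -> 'M[R]_(n, k)) :
  mxform M Z (\sum_(i <- r) W i) = \sum_(i <- r) mxform M Z (W i).
Proof. by rewrite /mxform mulmx_sumr raddf_sum. Qed.

Lemma mxquadZ n k (M : 'M[R]_n) a (Z : 'M[R]_(n, k)) :
  mxquad M (a *: Z) = a ^+ 2 * mxquad M Z.
Proof. by rewrite /mxquad mxformZl mxformZr expr2 mulrA. Qed.

Lemma mxquadD n k (M : 'M[R]_n) (Z W : 'M[R]_(n, k)) :
  M^T = M -> mxquad M (Z + W) = mxquad M Z + 2 * mxform M Z W + mxquad M W.
Proof.
move=> Ms; rewrite /mxquad mxformDl !mxformDr (mxformC W Z Ms); ring.
Qed.

Lemma mxquad0r n k (M : 'M[R]_n) : mxquad M (0 : 'M[R]_(n, k)) = 0.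
Proof. by rewrite /mxquad /mxform mulmx0 mxtrace0. Qed.

Lemma mxquad_mxDl n k (A B : 'M[R]_n) (Z : 'M[R]_(n, k)) :
  mxquad (A + B) Z = mxquad A Z + mxquad B Z.
Proof. by rewrite /mxquad /mxform mulmxDr mulmxDl mxtraceD. Qed.

Lemma mxquad_mxN n k (A : 'M[R]_n) (Z : 'M[R]_(n, k)) :
  mxquad (- A) Z = - mxquad A Z.
Proof. by rewrite /mxquad /mxform mulmxN mulNmx raddfN. Qed.

Lemma mxquad_mxZ n k a (A : 'M[R]_n) (Z : 'M[R]_(n, k)) :
  mxquad (a *: A) Z = a * mxquad A Z.
Proof. by rewrite /mxquad /mxform -scalemxAr -scalemxAl mxtraceZ. Qed.

Lemma mxquad_congr n p k (B : 'M[R]_(p, n)) (M : 'M[R]_p) (Z : 'M[R]_(n, k)) :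
  mxquad (B^T *m M *m B) Z = mxquad M (B *m Z).
Proof. by rewrite /mxquad /mxform trmx_mul !mulmxA. Qed.

Lemma mxquadE n (M : 'M[R]_n) (x : 'cV[R]_n) :
  mxquad M x = (x^T *m M *m x) ord0 ord0.
Proof. by rewrite /mxquad /mxform /mxtrace big_ord1. Qed.

Lemma mxquad1E n k (Z : 'M[R]_(n, k)) :
  mxquad 1%:M Z = \sum_i \sum_j Z i j ^+ 2.
Proof.
rewrite /mxquad /mxform mulmx1 /mxtrace exchange_big /=; apply: eq_bigr => j _.
by rewrite mxE; apply: eq_bigr => i _; rewrite mxE expr2.
Qed.

Lemma mxquad1_ge0 n k (Z : 'M[R]_(n, k)) : 0 <= mxquad 1%:M Z.
Proof. by rewrite mxquad1E; do 2![apply: sumr_ge0 => ? _]; exact: sqr_ge0. Qed.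

Lemma mxquad1_eq0 n k (Z : 'M[R]_(n, k)) : (mxquad 1%:M Z == 0) = (Z == 0).
Proof.
apply/eqP/eqP => [Z0|->]; last exact: mxquad0r.
apply/matrixP => i j; rewrite mxE; apply/eqP; rewrite -sqrf_eq0.
move/eqP: Z0; rewrite mxquad1E psumr_eq0; last first.
  by move=> ? _; apply: sumr_ge0 => ? _; exact: sqr_ge0.
move=> /allP/(_ i (mem_index_enum _))/=.
rewrite psumr_eq0; last by move=> ? _; exact: sqr_ge0.
by move=> /allP/(_ j (mem_index_enum _)).
Qed.

Lemma mxquad_col n k (M : 'M[R]_n) (Z : 'M[R]_(n, k)) :
  mxquad M Z = \sum_j mxquad M (col j Z).
Proof.
rewrite /mxquad /mxform /mxtrace; apply: eq_bigr => j _; rewrite big_ord1.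
rewrite !mxE; apply: eq_bigr => i _; rewrite !mxE; congr (_ * _).
by apply: eq_bigr => l _; rewrite !mxE.
Qed.

Lemma mxquad_ge0 n k (M : 'M[R]_n) (Z : 'M[R]_(n, k)) :
  (forall x : 'cV[R]_n, 0 <= mxquad M x) -> 0 <= mxquad M Z.
Proof. by move=> M0; rewrite mxquad_col; apply: sumr_ge0. Qed.

Lemma posdef_ge0 n k (M : 'M[R]_n) (Z : 'M[R]_(n, k)) :
  posdef M -> 0 <= mxquad M Z.
Proof.
move=> [_ Mp]; apply: mxquad_ge0 => x; have [->|/Mp] := eqVneq x 0.
  by rewrite mxquad0r.
by rewrite mxquadE => /ltW.
Qed.

(** Compactness of the unit sphere yields a maximizer, and homogeneity extends the bound to all
    vectors. The dimension is [n.+1] so that the sphere is non-empty. *)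
Lemma mxquad_maximizer n (M : 'M[R]_n.+1) :
  exists2 v : 'cV[R]_n.+1, mxquad 1%:M v = 1 &
    forall x : 'cV[R]_n.+1, mxquad M x <= mxquad M v * mxquad 1%:M x.
Proof.
have cont (B : 'M[R]_n.+1) : continuous (fun v : 'rV[R]_n.+1 => mxquad B v^T).
  have -> : (fun v : 'rV[R]_n.+1 => mxquad B v^T) =
      (fun v => \sum_j (\sum_i v ord0 i * B i j) * v ord0 j).
    apply/funext => v; rewrite mxquadE mxE; apply: eq_bigr => j _.
    by rewrite !mxE trmxK.
  apply: (@continuous_big R _ (+%R)) => [|j _]; first exact: add_continuous.
  have /= cj : continuous (fun v : 'rV[R]_n.+1 => \sum_i v ord0 i * B i j).
    apply: (@continuous_big R _ (+%R)) => [|i _]; first exact: add_continuous.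
    move=> v; apply: continuousM (@cst_continuous _ _ (B i j) v).
    exact: (@coord_continuous R 1 n.+1 ord0 i v).
  move=> v; exact: (continuousM (cj v) (@coord_continuous R 1 n.+1 ord0 j v)).
pose S := [set v : 'rV[R]_n.+1 | mxquad 1%:M v^T = 1].
have Sc : compact S.
  apply: bounded_closed_compact.
    (* Vectors carry the maximum norm, and the square of each entry is at most the sum of all
       squares, which is 1. *)
    exists 1; split=> // b b1 v /= Sv.
    rewrite [leLHS]/Num.norm /= mx_normrE.
    apply/bigmax_leP; split => [|[i j] _ /=].
      by rewrite (le_trans _ (ltW b1)).
    apply: le_trans (ltW b1); rewrite -(@ler_pXn2r _ 2) ?nnegrE//.
    rewrite expr1n real_normK ?num_real// -Sv mxquad1E (bigD1 j)//= big_ord1.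
    rewrite mxE (ord1 i) lerDl; do 2![apply: sumr_ge0 => ? _].
    exact: sqr_ge0.
  rewrite (_ : S = (fun v => mxquad 1%:M v^T) @^-1` [set x | x = 1])//.
  by apply: preimage_closed (@closed_eq _ _) => x _; exact: cont.
have [|w] := compact_EVT_max _ Sc (continuous_subspaceT (cont M)).
  exists (delta_mx ord0 ord0); rewrite /S /= mxquad1E (bigD1 ord0)//= big_ord1.
  rewrite !mxE !eqxx expr1n big1 ?addr0// => i /negPf i0.
  by rewrite big_ord1 !mxE i0 andbF expr0n.
rewrite inE => Sw wmax; exists w^T => // x.
have [->|x0] := eqVneq x 0; first by rewrite !mxquad0r mulr0.
pose c := Num.sqrt (mxquad 1%:M x).
have x_gt0 : 0 < mxquad 1%:M x by rewrite lt_def mxquad1_eq0 x0 mxquad1_ge0.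
have c2 : c ^+ 2 = mxquad 1%:M x by rewrite sqr_sqrtr// ltW.
have c0 : c != 0 by rewrite gt_eqF// sqrtr_gt0.
have /wmax : (c^-1 *: x)^T \in S.
  by rewrite inE /S /= trmxK mxquadZ -c2 -exprMn mulVf// expr1n.
by rewrite trmxK mxquadZ exprVn c2 mulrC ler_pdivrMr.
Qed.

(** A maximizer of [- M] on the unit sphere minimises [M] there, and the minimum is positive.
    Summing over columns keeps the same [e] for every [k]. *)
Lemma posdef_coercive n (M : 'M[R]_n) : posdef M ->
  exists2 e : R, 0 < e &
    forall k (Z : 'M[R]_(n, k)), e * mxquad 1%:M Z <= mxquad M Z.
Proof.
case: n M => [|n] M [_ Mp].
  by exists 1 => // k Z; rewrite (flatmx0 Z) !mxquad0r mulr0.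
have [v v1 vmax] := mxquad_maximizer (- M).
exists (mxquad M v) => [|k Z].
  rewrite mxquadE; apply: Mp; apply: contra_eq_neq v1 => ->.
  by rewrite mxquad0r eq_sym oner_eq0.
rewrite (mxquad_col _ Z) (mxquad_col M Z) mulr_sumr; apply: ler_sum => j _.
by have := vmax (col j Z); rewrite !mxquad_mxN mulNr lerN2.
Qed.

Lemma mxquad_dominated n (M : 'M[R]_n) : exists2 c : R, 0 < c &
  forall k (Z : 'M[R]_(n, k)), mxquad M Z <= c * mxquad 1%:M Z.
Proof.
case: n M => [|n] M.
  by exists 1 => // k Z; rewrite (flatmx0 Z) !mxquad0r mulr0.
have [v v1 vmax] := mxquad_maximizer M.
(* The absolute value and the added 1 make the constant positive whatever the sign of the
   maximum. *)
exists (`|mxquad M v| + 1) => [|k Z]; first by rewrite ltr_wpDl.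
rewrite (mxquad_col M Z) (mxquad_col _ Z) mulr_sumr; apply: ler_sum => j _.
apply: le_trans (vmax _) _; apply: ler_wpM2r; first exact: mxquad1_ge0.
by rewrite (le_trans (ler_norm _))// lerDl.
Qed.

(* The residual form [c x'x - x'Mx] is nonnegative and vanishes at the
   maximizer, which is therefore in its kernel. *)
Lemma max_eigenvalue n (M : 'M[R]_n.+1) : M^T = M ->
  exists2 c, eigenvalue M c &
    forall x : 'cV[R]_n.+1, mxquad M x <= c * mxquad 1%:M x.
Proof.
move=> Ms; have [v v1 vmax] := mxquad_maximizer M.
exists (mxquad M v) => //; set c := mxquad M v in vmax *.
pose S := c%:M - M.
have Ss : S^T = S by rewrite /S linearB /= tr_scalar_mx Ms.
have S0 (x : 'cV[R]_n.+1) : 0 <= mxquad S x.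
  by rewrite /S -scalemx1 mxquad_mxDl mxquad_mxN mxquad_mxZ subr_ge0 vmax.
have Sv : mxquad S v = 0.
  by rewrite /S -scalemx1 mxquad_mxDl mxquad_mxN mxquad_mxZ v1 mulr1 subrr.
have Skv : S *m v = 0.
  apply/eqP; rewrite -mxquad1_eq0; set u := S *m v.
  have uv : mxform S v u = mxquad 1%:M u.
    by rewrite /mxquad /mxform mulmx1 /u trmx_mul Ss !mulmxA.
  have [c' c'0 /(_ _ u) Su] := mxquad_dominated S.
  rewrite eq_le mxquad1_ge0 andbT.
  (* [S] vanishes at [v] and is at most [c' |u|^2] at [u], so nonnegativity at [v - u / c'] forces
     [0 <= - |u|^2 / c']. *)
  have := S0 (v + (- c'^-1) *: u).
  rewrite mxquadD// Sv add0r mxformZr mxquadZ uv sqrrN exprVn => h.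
  have : c'^-1 ^+2 * mxquad S u <= c'^-1 * mxquad 1%:M u.
    rewrite expr2 -mulrA ler_pM2l ?invr_gt0//.
    by rewrite mulrC ler_pdivrMr// mulrC.
  rewrite exprVn => h2.
  have h3 : c'^-1 * mxquad 1%:M u <= 0 by lra.
  by move: h3; rewrite pmulr_rle0 ?invr_gt0.
(* [eigenvalue] is about row eigenvectors, whence the transpose. *)
apply/eigenvalueP; exists v^T; last first.
  apply: contra_eq_neq v1 => /eqP; rewrite trmx_eq0 => /eqP->.
  by rewrite mxquad0r eq_sym oner_eq0.
rewrite -[LHS]trmxK trmx_mul trmxK Ms -[RHS]trmxK linearZ/= trmxK; congr (_^T).
by apply/esym/eqP; rewrite -subr_eq0 -mul_scalar_mx -mulmxBl; apply/eqP.
Qed.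

(** Cholesky factorisation: split off the first coordinate and apply the induction hypothesis to the
    Schur complement [D']. *)
Lemma posdef_factor n (M : 'M[R]_n) : posdef M ->
  exists F : 'M[R]_n, M = F^T *m F.
Proof.
elim: n M => [|n IHn] M [Ms Mp].
  by exists 0; apply/matrixP => -[].
pose M' : 'M[R]_(1 + n) := M.
have M'E : M' = block_mx (ulsubmx M') (ursubmx M') (dlsubmx M') (drsubmx M').
  by rewrite submxK.
set a := M' 0 0; set v := ursubmx M'; set D := drsubmx M'.
have ulE : ulsubmx M' = a%:M.
  by rewrite [LHS]mx11_scalar !mxE; congr ((M' _ _)%:M); exact/val_inj.
have M's : M'^T = M' by [].
have dlE : dlsubmx M' = v^T by rewrite -{1}M's -trmx_ursub.
have Ds : D^T = D by rewrite /D trmx_drsub M's.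
rewrite ulE dlE -/v -/D in M'E.
have Mq (x : R) (y : 'cV[R]_n) : mxquad M' (col_mx x%:M y) =
    a * x ^+ 2 + 2 * x * mxform 1%:M v^T y + mxquad D y.
  rewrite M'E /mxquad /mxform tr_col_mx mul_row_block mul_row_col.
  rewrite !mulmxDl !mxtraceD mulmx1 trmxK tr_scalar_mx.
  rewrite -!mulmxA !mul_scalar_mx !mul_mx_scalar !linearZ /= mxtrace_scalar.
  rewrite -[\tr (y^T *m v^T)]mxtrace_tr trmx_mul !trmxK !mulmxA; ring.
have Mpos (x : R) (y : 'cV[R]_n) : (x != 0) || (y != 0) ->
    0 < mxquad M' (col_mx x%:M y).
  move=> xy; rewrite mxquadE; apply: Mp; apply: contraTneq xy => xy0.
  have := congr1 (@usubmx _ 1 n 1) xy0; rewrite (col_mxKu x%:M y) => x0.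
  have := congr1 (@dsubmx _ 1 n 1) xy0; rewrite (col_mxKd x%:M y) => ->.
  have := congr1 (fun A : 'M[R]_1 => A 0 0) x0; rewrite !mxE /= mulr1n => ->.
  by rewrite eqxx /= negbK; apply/eqP/matrixP => i j; rewrite !mxE.
have a0 : 0 < a.
  have := Mpos 1 0; rewrite Mq oner_eq0 mxquad0r expr1n mulr1 addr0.
  by rewrite /mxform mulmx0 mxtrace0 mulr0 addr0; apply.
pose D' := D - a^-1 *: (v^T *m v).
have [|F' D'E] := IHn D'.
  split=> [|y y0]; first by rewrite /D' linearB linearZ /= trmx_mul trmxK Ds.
  rewrite -mxquadE.
  (* For fixed [y] this first coordinate minimises the form, and the minimum is the value of the
     Schur complement at [y]. *)
  have := Mpos (- a^-1 * mxform 1%:M v^T y) y; rewrite y0 orbT => /(_ isT).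
  rewrite Mq /D' mxquad_mxDl mxquad_mxN mxquad_mxZ.
  have -> : mxquad (v^T *m v) y = mxform 1%:M v^T y ^+ 2.
    rewrite /mxquad /mxform mulmx1 trmxK !mulmxA -(mulmxA _ v y).
    rewrite [v *m y]mx11_scalar mul_mx_scalar mxtraceZ mxtrace_scalar.
    rewrite -[\tr (y^T *m v^T)]mxtrace_tr trmx_mul !trmxK.
    by rewrite {2}[v *m y]mx11_scalar mxtrace_scalar mulr1n expr2.
  move=> h; apply: lt_le_trans h _.
  rewrite le_eqVlt; apply/orP; left; apply/eqP.
  by field; rewrite gt_eqF.
pose s := Num.sqrt a.
have s2 : s ^+ 2 = a by rewrite sqr_sqrtr// ltW.
have s0 : s != 0 by rewrite gt_eqF// sqrtr_gt0.
suff M'F : M' = (block_mx s%:M (s^-1 *: v) 0 F')^T *m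
    block_mx s%:M (s^-1 *: v) 0 F' by exists (block_mx s%:M (s^-1 *: v) 0 F').
rewrite M'E tr_block_mx mulmx_block.
have vT : (s^-1 *: v)^T = s^-1 *: v^T by rewrite linearZ.
rewrite !trmx0 !mul0mx !mulmx0 !addr0 vT tr_scalar_mx.
rewrite !mul_scalar_mx !mul_mx_scalar -scalemxAl -scalemxAr !scalerA.
rewrite -D'E /D' -expr2 exprVn s2 mulfV// !scale1r.
by rewrite addrC subrK scale_scalar_mx -expr2 s2.
Qed.

(** The form of [Q] is at least [e |x|^2] and that of [d *: X] at most [d c |x|^2]; the factor 2 in
    the witness makes the comparison strict. *)
Lemma posdef_small_sub n (Q X : 'M[R]_n) : posdef Q -> X^T = X ->
  exists2 e : R, 0 < e & forall d, 0 < d -> d <= e -> posdef (Q - d *: X).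
Proof.
move=> Qp Xs; have [Qs _] := Qp.
have [e e0 eQ] := posdef_coercive Qp; have [c c0 cX] := mxquad_dominated X.
exists (e / (2 * c)) => [|d d0 de]; first by rewrite divr_gt0// mulr_gt0.
split=> [|x x0]; first by rewrite linearB linearZ /= Qs Xs.
rewrite -mxquadE mxquad_mxDl mxquad_mxN mxquad_mxZ subr_gt0.
have x1 : 0 < mxquad 1%:M x by rewrite lt_def mxquad1_eq0 x0 mxquad1_ge0.
apply: lt_le_trans (eQ _ x).
apply: (@le_lt_trans _ _ (d * (c * mxquad 1%:M x))).
  by rewrite ler_pM2l.
rewrite mulrA ltr_pM2r//; apply: (@le_lt_trans _ _ (e / (2 * c) * c)).
  by rewrite ler_pM2r.
rewrite invfM mulrA -mulrA mulVf ?mulr1 ?gt_eqF//; lra.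
Qed.

End MatrixForms.

(** * Laplacians *)

Section Laplacian.
Variables (R : realType) (N : nat).

(** The vector is 1 at one end of the edge, -1 at the other and 0 elsewhere. The arbitrary
    orientation cancels in products of two entries. *)
Lemma incidence_vector (e : {set 'I_N}) : #|e| = 2%N ->
  exists b : 'cV[R]_N, [/\ \sum_i b i ord0 = 0, mxquad 1%:M b = 2 &
    forall i j, i != j ->
      b i ord0 * b j ord0 = if [set i; j]%SET == e then -1 else 0].
Proof.
move=> /eqP/cards2P[x [y [xy ->]]].
pose b : 'cV[R]_N := \col_i ((i == x)%:R - (i == y)%:R).
have sum1 (z : 'I_N) : \sum_i (i == z)%:R = 1 :> R.
  by rewrite (bigD1 z)//= eqxx big1 ?addr0// => i /negPf->.
exists b; split.
- under eq_bigr do rewrite mxE.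
  by rewrite sumrB !sum1 subrr.
- rewrite mxquad1E; under eq_bigr do rewrite big_ord1 mxE.
  rewrite (eq_bigr (fun i => (i == x)%:R + (i == y)%:R)) => [|i _].
    by rewrite big_split /= !sum1.
  by have [->|_] := eqVneq i x; have [|_] := eqVneq _ y => [/eqP|];
    rewrite ?(negPf xy)//= ?mulr1n ?mulr0n; lra.
- move=> i j ij; rewrite !mxE.
  have -> : ([set i; j]%SET == [set x; y]%SET) =
      (i == x) && (j == y) || (i == y) && (j == x).
    apply/eqP/orP => [E|[/andP[/eqP-> /eqP->]|/andP[/eqP-> /eqP->]]//].
      move: ij (set21 i j) (set22 i j); rewrite E !inE.
      have [->|_] := eqVneq i x; have [->|_] := eqVneq j x; rewrite ?eqxx//=.
      - by move=> _ _ ->; left.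
      - by move=> _ ->; right.
      - by move=> + /eqP iy /eqP jy; rewrite iy jy eqxx.
    by rewrite finset.setUC.
  move: ij xy; have [->|ix] := eqVneq i x; have [->|jx] := eqVneq j x => //=.
  + move=> _; rewrite [x == y]eq_sym => yx; rewrite (negPf yx) andbF orbF.
    by case: (j == y); rewrite /= ?mulr1n ?mulr0n; lra.
  + move=> _ xy; rewrite (negPf xy) /= andbT.
    by case: (i == y); rewrite /= ?mulr1n ?mulr0n; lra.
  + rewrite andbF /= => ij _.
    by have [iy|_] := eqVneq i y; have [jy|_] := eqVneq j y;
      rewrite ?subrr ?mulr0 ?mul0r//; move: ij; rewrite iy jy eqxx.
Qed.

(** Off the diagonal, injectivity of [e] leaves at most one contributing edge. The diagonal follows
    because the entries of each [b t] sum to 0. *)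
Lemma laplacian_sum (T : finType) (e : T -> {set 'I_N}) (b : T -> 'cV[R]_N) :
  injective e -> (forall t, \sum_i b t i ord0 = 0) ->
  (forall t i j, i != j ->
    b t i ord0 * b t j ord0 = if [set i; j]%SET == e t then -1 else 0) ->
  forall A : {set T},
    laplacian R [set e t | t in A]%SET = \sum_(t in A) b t *m (b t)^T.
Proof.
move=> e_inj b0 be A.
have off i j : i != j -> laplacian_offdiag R [set e t | t in A]%SET i j =
    \sum_(t in A) b t i ord0 * b t j ord0.
  move=> ij; rewrite /laplacian_offdiag; case: imsetP => [[t tA Et]|ne].
    rewrite (bigD1 t)//= be// Et eqxx big1 ?addr0 => // s /andP[sA st].
    by rewrite be// Et (inj_eq e_inj) eq_sym (negPf st).
  rewrite big1// => t tA; rewrite be//; case: eqP => // E.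
  by case: ne; exists t.
apply/matrixP => i j; rewrite mxE summxE.
rewrite [RHS](eq_bigr (fun t => b t i ord0 * b t j ord0)) => [|t _]; last first.
  by rewrite !mxE big_ord1 mxE.
have [->|ij] := eqVneq i j; last exact: off.
rewrite (eq_bigr (fun l => \sum_(t in A) b t j ord0 * b t l ord0)).
  rewrite exchange_big /= -sumrN; apply: eq_bigr => t _.
  have := b0 t; rewrite (bigD1 j)//= => /eqP; rewrite addr_eq0 => /eqP bj.
  by rewrite -mulr_sumr {3}bj mulrN.
by move=> l lj; rewrite off// eq_sym.
Qed.

(** A single family [b] serves every subset [A], so the nominal graph and all modes share their
    incidence vectors. *)
Lemma laplacian_incidence (E0 : {set {set 'I_N}}) : simple_graph E0 ->
  exists b : edge_of E0 -> 'cV[R]_N,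
    (forall e, mxquad 1%:M (b e) = 2) /\
    forall A : {set edge_of E0},
      laplacian R [set val e | e in A]%SET = \sum_(e in A) b e *m (b e)^T.
Proof.
move=> simple.
have /choice[b hb] (e : edge_of E0) := incidence_vector (simple _ (valP e)).
exists b; split=> [e|A]; first by have [] := hb e.
apply: (laplacian_sum (e := val)); first exact: val_inj.
  by move=> e; have [] := hb e.
by move=> e i j ij; have [_ _] := hb e; exact.
Qed.

Lemma sum_mxquad_mulmx (T : finType) (b : T -> 'cV[R]_N) n (M : 'M[R]_n)
    (Y : 'M[R]_(n, N)) :
  \sum_t mxquad M (Y *m b t) = mxform M Y (Y *m \sum_t b t *m (b t)^T).
Proof.
rewrite mulmx_sumr mxform_sumr; apply: eq_bigr => t _.
by rewrite /mxquad /mxform trmx_mul -!mulmxA mxtrace_mulC !mulmxA.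
Qed.

End Laplacian.

(** * Modes and Bernoulli packet losses *)

Section Modes.

(* The state, in mode number i, of the edge number l out of m; edge 0 carries
   the most significant bit. *)
Definition mode_bit (m i l : nat) : bool := odd (i %/ 2 ^ (m - l.+1)).

Lemma ltn_binary_sum m (t : nat -> bool) :
  (\sum_(l < m) t l * 2 ^ (m - l.+1) < 2 ^ m)%N.
Proof.
elim: m t => [|m IHm] t; first by rewrite big_ord0.
rewrite big_ord_recl subSS subn0.
have := IHm (t \o S); rewrite expnS.
set S := (\sum_(l < m) _)%N => ltS.
by case: (t ord0); lia.
Qed.

Lemma mode_bit_sum m (t : nat -> bool) l : (l < m)%N ->
  mode_bit m (\sum_(j < m) t j * 2 ^ (m - j.+1)) l = t l.
Proof.
rewrite /mode_bit; elim: m t l => [//|m IHm] t l lm.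
rewrite big_ord_recl subSS subn0.
have E : (\sum_(i < m) t (lift ord0 i) * 2 ^ (m.+1 - (lift ord0 i).+1) =
    \sum_(i < m) (t \o S) i * 2 ^ (m - i.+1))%N.
  by apply: eq_bigr => i _; rewrite /= /bump /= add1n subSS.
rewrite E; case: l lm => [|l] lm.
  rewrite subSS subn0 divnMDl ?expn_gt0// divn_small ?addn0 ?oddb//.
  exact: ltn_binary_sum.
(* After the division the leading term is a multiple of [2 ^ l.+1], hence does not affect the
   parity. *)
rewrite subSS -[in X in (_ * 2 ^ X + _)%N](@subnK l.+1 m)// expnD mulnCA mulnC.
by rewrite divnMDl ?expn_gt0// oddD IHm//= oddM oddX andbF.
Qed.

(** Here the induction removes the least significant bit by halving [i]. Together with
    [mode_bit_sum] this identifies modes with edge states. *)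
Lemma sum_mode_bit m i : (i < 2 ^ m)%N ->
  (\sum_(l < m) mode_bit m i l * 2 ^ (m - l.+1) = i)%N.
Proof.
elim: m i => [|m IHm] i im; first by rewrite big_ord0; move: im; case: i.
rewrite big_ord_recr /= subnn muln1 /mode_bit subnn divn1.
rewrite (eq_bigr (fun l : 'I_m => 2 * (mode_bit m i./2 l * 2 ^ (m - l.+1)))%N).
  rewrite -big_distrr /= IHm; first by rewrite mul2n addnC odd_double_half.
  by rewrite ltn_half_double -mul2n -expnS.
move=> l _; rewrite /= subSn ?ltn_ord// expnS mulnCA /mode_bit.
by rewrite -divn2 divnMA.
Qed.

Lemma mode_edges_bit N (E0 : {set {set 'I_N}}) m (nu : edge_of E0 -> 'I_m)
    (i : 'I_(2 ^ m)) : bijective nu ->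
  mode_edges nu i =
    [set val e | e in [set e : edge_of E0 | mode_bit m i (nu e)]]%SET.
Proof.
move=> [nu' nuK nu'K]; rewrite /mode_edges.
have numE (th : {ffun edge_of E0 -> bool}) : mode_number nu th =
    (\sum_(l < m) th (nu' l) * 2 ^ (m - l.+1))%N.
  rewrite /mode_number (reindex nu') /=; last first.
    by exists nu => ? _; rewrite ?nuK ?nu'K.
  by apply: eq_bigr => l _; rewrite nu'K.
apply/setP => s; apply/imsetP/imsetP => -[e]; rewrite inE => + ->.
  move=> /existsP[th /andP[/eqP thi the]]; exists e => //.
  rewrite inE -thi numE.
  (* [mode_bit_sum] expects bits indexed by [nat]; [t] is [false] from [m] on. *)
  pose t l :=
    if @idP (l < m)%N is ReflectT lm then th (nu' (Ordinal lm)) else false.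
  have tE (l : 'I_m) : t l = th (nu' l).
    rewrite /t; case: {-}_ / idP => [lm|]; last by rewrite ltn_ord.
    by congr (th (nu' _)); exact: val_inj.
  under eq_bigr do rewrite -tE.
  by rewrite mode_bit_sum// tE nuK.
move=> ie; exists e => //; rewrite inE; apply/existsP.
exists [ffun e => mode_bit m i (nu e)]; rewrite ffunE ie andbT numE.
under eq_bigr do rewrite ffunE nu'K.
by rewrite sum_mode_bit.
Qed.

Variable R : realType.

(** The first Kronecker factor governs the most significant bit, which separates the modes below
    [2 ^ m] from the others. Taking [G] on [nat] lets both halves use it without casts. *)
Lemma sum_edge_distributionS m (p : 'I_m.+1 -> R) (G : nat -> R) :
  let q := edge_distribution (fun l => p (lift ord0 l)) in
  \sum_(i < 2 ^ m.+1) edge_distribution p i ord0 * G i =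
  (1 - p ord0) * \sum_(i < 2 ^ m) q i ord0 * G i +
  p ord0 * \sum_(i < 2 ^ m) q i ord0 * G (2 ^ m + i)%N.
Proof.
move=> q; pose h (bi : 'I_2 * 'I_(2 ^ m)) : 'I_(2 ^ m.+1) :=
  cast_ord (esym (expnS 2 m)) (mxtens_index bi).
rewrite (reindex h) /=; last first.
  exists (fun i => mxtens_unindex (cast_ord (expnS 2 m) i)) => bi _.
    by rewrite /h cast_ord_comp cast_ord_id mxtens_indexK.
  by rewrite /h mxtens_unindexK cast_ord_comp cast_ord_id.
transitivity (\sum_b \sum_i
    bernoulli_col (p ord0) b ord0 * q i ord0 * G (b * 2 ^ m + i)%N).
  rewrite pair_bigA /=; apply: eq_bigr => -[b i] _; congr (_ * _).
  rewrite castmxE cast_ord_comp cast_ord_id mxE mxtens_indexK /=.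
  by congr (bernoulli_col _ _ _ * q _ _); exact: val_inj.
rewrite big_ord_recl big_ord1 !mulr_sumr.
by congr (_ + _); apply: eq_bigr => i _; rewrite mxE /= ?mul0n ?mul1n mulrA.
Qed.

(* The variance of a Bernoulli variable of parameter p is p (1 - p); distinct
   bits are uncorrelated. *)
Lemma mxquad_mean n k (M : 'M[R]_n) m (p : 'I_m -> R) (C : 'M[R]_(n, k))
    (v : 'I_m -> 'M[R]_(n, k)) : M^T = M ->
  \sum_(i < 2 ^ m) edge_distribution p i ord0 *
     mxquad M (C + \sum_(l < m) (mode_bit m i l)%:R *: v l) =
  mxquad M (C + \sum_l p l *: v l) + \sum_l p l * (1 - p l) * mxquad M (v l).
Proof.
(* [C] is generalised so that it can absorb the term of the leading edge. *)
move=> Ms; elim: m p C v => [|m IHm] p C v.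
  by rewrite !big_ord0 big_ord_recl big_ord0 !big_ord0 !addr0 mxE mul1r.
pose G (i : nat) :=
  mxquad M (C + \sum_(l < m.+1) (mode_bit m.+1 i l)%:R *: v l).
rewrite (sum_edge_distributionS p G) /G.
have low (i : 'I_(2 ^ m)) (b : bool) (l : 'I_m) :
    mode_bit m.+1 (b * 2 ^ m + i) (lift ord0 l) = mode_bit m i l.
  rewrite /mode_bit /= /bump /= add1n subSS.
  rewrite -[in X in (_ * 2 ^ X + _)%N](@subnK l.+1 m)// expnD mulnCA mulnC.
  by rewrite divnMDl ?expn_gt0// oddD oddM oddX andbF.
have high (i : 'I_(2 ^ m)) (b : bool) : mode_bit m.+1 (b * 2 ^ m + i) 0%N = b.
  by rewrite /mode_bit subSS subn0 divnMDl ?expn_gt0// divn_small ?addn0 ?oddb.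
have split (i : 'I_(2 ^ m)) (b : bool) :
    mxquad M (C + \sum_(l < m.+1) (mode_bit m.+1 (b * 2 ^ m + i) l)%:R *: v l) =
    mxquad M (C + b%:R *: v ord0 +
              \sum_(l < m) (mode_bit m i l)%:R *: v (lift ord0 l)).
  rewrite big_ord_recl high addrA; congr (mxquad M (_ + _)).
  by apply: eq_bigr => l _; rewrite low.
rewrite (eq_bigr _ (fun i _ => congr1 _ (split i false))).
have split1 i := split i true; rewrite !mul1n in split1.
rewrite [X in _ + _ * X](eq_bigr _ (fun i _ => congr1 _ (split1 i))).
rewrite !IHm !big_ord_recl /= scale0r addr0 scale1r.
set S1 := \sum_l _ *: _; set S2 := \sum_l _ * _.
have -> : C + (p ord0 *: v ord0 + S1) = C + S1 + p ord0 *: v ord0.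
  by rewrite -addrA [S1 + _]addrC.
have -> : C + v ord0 + S1 = C + S1 + v ord0 by rewrite addrAC.
(* With [Z = C + S1], what remains is [(1 - p) |Z|^2 + p |Z + v|^2 = |Z + p v|^2 + p (1 - p)
   |v|^2]. *)
rewrite !mxquadD//= mxformZr mxquadZ; ring.
Qed.

End Modes.

(** * The matrix inequality on one edge *)

Section Dissipation.
Variable R : realType.

Lemma mxquad_block_diag n1 n2 k (A : 'M[R]_n1) (B : 'M[R]_n2)
    (Z : 'M[R]_(n1, k)) (W : 'M[R]_(n2, k)) :
  mxquad (block_mx A 0 0 B) (col_mx Z W) = mxquad A Z + mxquad B W.
Proof.
rewrite /mxquad /mxform tr_col_mx mul_row_block mul_row_col.
by rewrite !mulmx0 addr0 add0r mxtraceD.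
Qed.

Lemma negdef_opp n (M : 'M[R]_n) : negdef M -> posdef (- M).
Proof.
move=> [Ms Mn]; split=> [|x x0]; first by rewrite -[in RHS]Ms raddfN.
by rewrite mulmxN mulNmx mxE oppr_gt0; exact: Mn.
Qed.

Lemma castmx_mull p p' n k (e : p = p') (B : 'M[R]_(p, n)) (Z : 'M[R]_(n, k)) :
  castmx (e, erefl) B *m Z = castmx (e, erefl) (B *m Z).
Proof. by case: p' / e. Qed.

Lemma dim_2 n : (n + n = 2 * n)%N. Proof. by rewrite addnn mul2n. Qed.

(** The cast gives the index type [2 * n] on which [D *t 1%:M] acts. *)
Definition stack2 n (z1 z2 : 'cV[R]_n) : 'cV[R]_(2 * n) :=
  castmx (dim_2 n, erefl) (col_mx z1 z2).

Lemma stack2E n (z1 z2 : 'cV[R]_n) (c : 'I_2) (i : 'I_n) :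
  stack2 z1 z2 (mxtens_index (c, i)) ord0 =
  if c == ord0 then z1 i ord0 else z2 i ord0.
Proof.
rewrite castmxE mxE (ord1 (cast_ord _ _)).
case: splitP => /= j; rewrite /= => E; case: ifPn => [/eqP c0|c0].
- by congr (z1 _ _); apply: val_inj; rewrite /= -E c0.
- by move: c0 (ltn_ord j) E; case: c => -[|[|?]]//= _ _; lia.
- by move: (ltn_ord i); rewrite c0 /= in E; lia.
- congr (z2 _ _); apply: val_inj => /=; move: c0 E.
  by case: c => -[|[|?]]//= _ _; lia.
Qed.

Lemma block_row_I3E n (j : 'I_3) k (w : 'M[R]_(3 * n, k)) :
  block_row_I3 R n j *m w = rowsub (fun i => mxtens_index (j, i)) w.
Proof.
rewrite /block_row_I3 mul_rowsub_mx (_ : _ *t _ = 1%:M) ?mul1mx//.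
apply/matrixP => p q; case: (mxtens_indexP p) => p1 p2.
case: (mxtens_indexP q) => q1 q2; rewrite tensmxE !mxE.
rewrite (can_eq (@mxtens_indexK _ _)) xpair_eqE.
by case: (p1 == q1); case: (p2 == q2); rewrite ?mulr0 ?mul0r ?mulr1.
Qed.

Lemma block_row_I3_tens n (D : 'M[R]_(3, 2)) (j : 'I_3) (z1 z2 : 'cV[R]_n) :
  block_row_I3 R n j *m ((D *t (1%:M : 'M[R]_n)) *m stack2 z1 z2) =
  D j ord0 *: z1 + D j ord_max *: z2.
Proof.
rewrite block_row_I3E; apply/matrixP => i k; rewrite (ord1 k) !mxE.
rewrite (reindex (@mxtens_index 2 n)) /=; last first.
  exists (@mxtens_unindex 2 n) => ? _;
    by rewrite ?mxtens_indexK ?mxtens_unindexK.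
transitivity (\sum_(c < 2) \sum_(a < n)
   D j c * (1%:M : 'M[R]_n) i a * stack2 z1 z2 (mxtens_index (c, a)) ord0).
  by rewrite pair_bigA /=; apply: eq_bigr => -[c a] _; rewrite tensmxE.
have S c : \sum_(a < n) D j c * (1%:M : 'M[R]_n) i a *
    stack2 z1 z2 (mxtens_index (c, a)) ord0 =
    D j c * stack2 z1 z2 (mxtens_index (c, i)) ord0.
  rewrite (bigD1 i)//= mxE eqxx mulr1 big1 ?addr0// => a /negPf ai.
  by rewrite mxE eq_sym ai mulr0 mul0r.
rewrite big_ord_recl big_ord1 !S !stack2E /=.
by congr (_ + D j _ * _); exact: val_inj.
Qed.

(** Reconciles the row grouping of [Psi] with that of [multiplier_factor]. *)
Lemma castmx_stack2 n (w : 'cV[R]_(3 * n)) (z1 z2 : 'cV[R]_n) :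
  castmx (dim_3_1_1 n, erefl) (col_mx w (col_mx z1 z2)) =
  castmx (dim_3_2 n, erefl) (col_mx w (stack2 z1 z2)).
Proof.
have e12 : (3 * n + (n + n) = 3 * n + 2 * n)%N by rewrite dim_2.
rewrite /stack2 -[w in RHS](castmx_id (erefl, erefl)).
rewrite -(castmx_col _ _ e12) castmx_comp.
by congr (castmx (_, _) _); exact: eq_irrelevance.
Qed.

(** The block rows of [Psi] send [(x, w)] to the current state, the next state, the variance signal,
    and the input-output pair of the channel seen by [P]. *)
Lemma middle_mx_Psi n (Ad Ac X : 'M[R]_n) (P : 'M[R]_(5 * n)) lambda
    (x : 'cV[R]_n) (w : 'cV[R]_(3 * n)) :
  let I j := block_row_I3 R n (inord j) in
  mxquad ((Psi Ad Ac lambda)^T *m middle_mx X P *m Psi Ad Ac lambda)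
    (col_mx x w) =
  - mxquad X x + mxquad X (Ad *m x + Num.sqrt lambda *: (I 0 *m w)) +
  2 * mxquad X (I 1 *m w) +
  mxquad P (castmx (dim_3_2 n, erefl)
    (col_mx w (stack2 (I 2 *m w) (Num.sqrt lambda *: (Ac *m x))))).
Proof.
move=> I; rewrite mxquad_congr /Psi /=.
rewrite !(mul_col_mx, mul_row_col, castmx_mull, mul1mx, mul0mx, addr0, add0r).
rewrite -!scalemxAl castmx_stack2 /middle_mx !mxquad_block_diag.
by rewrite mxquad_mxN mxquad_mxZ !addrA.
Qed.

Variables (n : nat) (Ad Ac X : 'M[R]_n) (P : 'M[R]_(5 * n)) (rl ru : R).
Hypothesis rl0 : 0 <= rl.
Hypothesis ru1 : ru <= 1.
Hypothesis multiplier : forall D, Delta_set rl ru D ->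
  posdef ((multiplier_factor n D)^T *m P *m multiplier_factor n D).

(* The channel [w = (D (x) I) z], closed with [z1 = a z2], realises
   [w1 = t z2] and [w2 = sqrt (t (1 - t)) z2]; the multiplier term is then
   nonnegative and drops out. *)
Lemma edge_dissipation lambda : 0 <= lambda ->
  negdef ((Psi Ad Ac lambda)^T *m middle_mx X P *m Psi Ad Ac lambda) ->
  exists2 e : R, 0 < e & forall (x : 'cV[R]_n) t, rl <= t <= ru ->
    - mxquad X x + mxquad X (Ad *m x + (lambda * t) *: (Ac *m x)) +
    2 * (t * (1 - t)) * lambda * mxquad X (Ac *m x) <= - e * mxquad 1%:M x.
Proof.
move=> lambda0 /negdef_opp/posdef_coercive[e e0 eP]; exists e => // x t tr.
have [t0 t1] : 0 <= t /\ 0 <= 1 - t by move: tr rl0 ru1 => /andP[]; lra.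
pose a := Num.sqrt t; pose b := Num.sqrt (1 - t); pose s := Num.sqrt lambda.
have a2 : a ^+ 2 = t by rewrite sqr_sqrtr.
have b2 : b ^+ 2 = 1 - t by rewrite sqr_sqrtr.
have s2 : s ^+ 2 = lambda by rewrite sqr_sqrtr.
pose z2 := s *: (Ac *m x); pose z1 := a *: z2.
pose w : 'cV[R]_(3 * n) := (Delta_mx a b *t (1%:M : 'M[R]_n)) *m stack2 z1 z2.
have w1 : block_row_I3 R n (inord 0) *m w = a *: z1.
  by rewrite block_row_I3_tens !mxE !inordK//= scale0r addr0.
have w2 : block_row_I3 R n (inord 1) *m w = b *: z1.
  by rewrite block_row_I3_tens !mxE !inordK//= scale0r addr0.
have w3 : block_row_I3 R n (inord 2) *m w = z1.
  by rewrite block_row_I3_tens !mxE !inordK//= scale0r add0r.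
have : 0 <= mxquad P (castmx (dim_3_2 n, erefl) (col_mx w (stack2 z1 z2))).
  have <- : multiplier_factor n (Delta_mx a b) *m stack2 z1 z2 =
      castmx (dim_3_2 n, erefl) (col_mx w (stack2 z1 z2)).
    by rewrite castmx_mull mul_col_mx mul1mx.
  rewrite -mxquad_congr; apply/posdef_ge0/multiplier.
  by exists a, b; rewrite !sqrtr_ge0 a2 b2.
have := eP _ (col_mx x w).
rewrite mxquad_mxN middle_mx_Psi w1 w2 w3 -/s -/z2.
have -> : s *: (a *: z1) = (lambda * t) *: (Ac *m x).
  by rewrite /z1 /z2 !scalerA -s2 -a2; congr (_ *: _); ring.
have -> : b *: z1 = (b * a * s) *: (Ac *m x) by rewrite /z1 /z2 !scalerA.
(* The decay obtained is in [|x|^2 + |w|^2]; only the part in [x] is kept. *)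
have x_le : mxquad 1%:M x <= mxquad 1%:M (col_mx x w).
  rewrite (_ : (1%:M : 'M[R]_(n + 3 * n)) = block_mx 1%:M 0 0 1%:M).
    by rewrite mxquad_block_diag lerDl mxquad1_ge0.
  by rewrite -scalar_mx_block.
rewrite mxquadZ (_ : (b * a * s) ^+ 2 = t * (1 - t) * lambda); last first.
  by rewrite !exprMn s2 a2 b2; ring.
move: x_le; rewrite -(ler_pM2l e0) mulNr => h1 h2 h3.
rewrite -!mulrA in h2 *; lra.
Qed.

End Dissipation.

(** * Contraction of the network *)

Section Network.
Variable R : realType.

Lemma mxform_outer n N (M : 'M[R]_n) (Z : 'M[R]_(n, N)) (w : 'cV[R]_n)
    (b : 'cV[R]_N) :
  mxform M Z (w *m b^T) = mxform M (Z *m b) w.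
Proof. by rewrite /mxform trmx_mul mulmxA mxtrace_mulC !mulmxA. Qed.

Lemma mxquad_outer n N (M : 'M[R]_n) (w : 'cV[R]_n) (b : 'cV[R]_N) :
  mxquad M (w *m b^T) = mxquad 1%:M b * mxquad M w.
Proof.
rewrite {1}/mxquad mxform_outer -mulmxA [b^T *m b]mx11_scalar mul_mx_scalar.
by rewrite mxformZl mxquadE mulmx1.
Qed.

Variables (N m : nat) (b : 'I_m -> 'cV[R]_N) (lambda : R).
Hypothesis lambda0 : 0 < lambda.
Let L := \sum_l b l *m (b l)^T.
Hypothesis L_le : forall y : 'cV[R]_N, mxquad L y <= lambda * mxquad 1%:M y.

(** Writing [Q] as [F^T *m F] and [W = F *m Z] turns the sum into the trace of [W L W^T], to which
    [L_le] applies row by row of [W]. *)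
Lemma sum_mxquad_le n (Q : 'M[R]_n) (Z : 'M[R]_(n, N)) : posdef Q ->
  \sum_l mxquad Q (Z *m b l) <= lambda * mxquad Q Z.
Proof.
move=> /posdef_factor[F ->].
have FE k (W : 'M[R]_(n, k)) : mxquad (F^T *m F) W = mxquad 1%:M (F *m W).
  by rewrite -mxquad_congr mulmx1.
under eq_bigr do rewrite FE mulmxA.
rewrite FE sum_mxquad_mulmx -/L; set W := F *m Z.
have -> : mxform 1%:M W (W *m L) = mxquad L W^T.
  rewrite /mxquad /mxform mulmx1 mxtrace_mulC trmxK -!mulmxA mxtrace_mulC.
  by rewrite !mulmxA.
have -> : mxquad 1%:M W = mxquad 1%:M W^T.
  by rewrite /mxquad /mxform !mulmx1 trmxK mxtrace_mulC.
rewrite mxquad_col [leRHS]mulrC mxquad_col mulr_suml.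
by apply: ler_sum => j _; rewrite mulrC.
Qed.

(* The nonzero spectra of [B B^T] and [B^T B] agree, where [B] has the columns
   [b l]: expand the sum of the squares of [lambda w_l - Z b_l]. *)
Lemma mxquad_sum_outer_le n (Q : 'M[R]_n) (w : 'I_m -> 'cV[R]_n) : posdef Q ->
  mxquad Q (\sum_l w l *m (b l)^T) <= lambda * \sum_l mxquad Q (w l).
Proof.
move=> Qp; have Qs := Qp.1; set Z := \sum_l _.
have ZE : \sum_l mxform Q (w l) (Z *m b l) = mxquad Q Z.
  rewrite /mxquad {3}/Z mxform_sumr; apply: eq_bigr => l _.
  by rewrite mxform_outer mxformC.
have : 0 <= \sum_l mxquad Q (lambda *: w l + (-1) *: (Z *m b l)).
  by apply: sumr_ge0 => l _; exact: posdef_ge0.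
have -> : \sum_l mxquad Q (lambda *: w l + (-1) *: (Z *m b l)) =
    lambda ^+ 2 * (\sum_l mxquad Q (w l)) +
    (- (2 * lambda)) * (\sum_l mxform Q (w l) (Z *m b l)) +
    \sum_l mxquad Q (Z *m b l).
  rewrite !mulr_sumr -!big_split; apply: eq_bigr => l _ /=.
  by rewrite mxquadD// mxformZl mxformZr !mxquadZ; ring.
(* Now [0 <= lambda^2 s - 2 lambda |Z|^2 + lambda |Z|^2], where [s] is the sum of the [|w l|^2];
   divide by [lambda]. *)
rewrite ZE => h1; have h2 := sum_mxquad_le Z Qp.
rewrite -(ler_pM2l lambda0); lra.
Qed.

Hypothesis b2 : forall l, mxquad 1%:M (b l) = 2.
Variables (n : nat) (Ad Ac X : 'M[R]_n) (rl ru : R).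
Hypothesis Xp : posdef X.
Hypothesis Ad_neg : negdef (Ad^T *m X *m Ad - X).
Variable e : R.
Hypothesis e0 : 0 < e.
Hypothesis edge : forall (l : 'I_m) (x : 'cV[R]_n) t, rl <= t <= ru ->
  - mxquad X x + mxquad X (Ad *m x + (lambda * t) *: (Ac *m x)) +
  2 * (t * (1 - t)) * lambda * mxquad X (Ac *m x) <= - e * mxquad 1%:M x.

(** By [mxquad_mean] the mean is a squared norm plus variances. Bounding the squared coupling by
    [mxquad_sum_outer_le] leaves an excess of at most [S] over [|Ad Y|^2], and [Q - d *: X] absorbs
    [S]. *)
Lemma network_contraction : exists d : R, [/\ 0 < d, d < 1 &
  forall (p : 'I_m -> R) (Y : 'M[R]_(n, N)), (forall l, rl <= p l <= ru) ->
  \sum_(i < 2 ^ m) edge_distribution p i ord0 *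
    mxquad X (Ad *m Y + Ac *m Y *m
      \sum_(l < m) (mode_bit m i l)%:R *: (b l *m (b l)^T)) <=
  (1 - d) * mxquad X Y].
Proof.
have Xs := Xp.1; pose Q := X - Ad^T *m X *m Ad.
have Qp : posdef Q by rewrite /Q -opprB; exact: negdef_opp.
have [d1 d10 d1Q] := posdef_small_sub Qp Xs.
have [c c0 cX] := mxquad_dominated X.
(* The bound [d1] keeps [Q - d *: X] positive definite, [e / c] lets the edge decay pay for
   [d *: X], and 1/2 ensures [d < 1]. *)
pose d := Num.min (Num.min d1 (e / c)) 2^-1.
have d0 : 0 < d by rewrite !lt_min d10 divr_gt0//= invr_gt0.
have dd1 : d <= d1 by rewrite !ge_min lexx.
have dec : d <= e / c by rewrite !ge_min lexx orbT.
have d_half : d <= 2^-1 by rewrite ge_min lexx orbT.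
exists d; split=> // [|p Y pr]; first by rewrite (le_lt_trans d_half)//; lra.
have Qdp := d1Q _ d0 dd1.
have QdE k (Z : 'M[R]_(n, k)) : mxquad (Q - d *: X) Z =
    mxquad X Z - mxquad X (Ad *m Z) - d * mxquad X Z.
  by rewrite !(mxquad_mxDl, mxquad_mxN) mxquad_mxZ mxquad_congr.
pose u l := Y *m b l; pose z l := Ac *m u l.
pose S := \sum_l (2 * (p l * mxform X (Ad *m u l) (z l)) +
  lambda * (p l ^+ 2 * mxquad X (z l)) +
  2 * (p l * (1 - p l) * mxquad X (z l))).
have S_le : S <= mxquad (Q - d *: X) Y.
  (* [lambda] times the summand of [S] at [l] is at most the form of [Q - d *: X] at [Y *m b l], by
     the edge inequality; [sum_mxquad_le] bounds the sum of these. *)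
  rewrite -(ler_pM2l lambda0); apply: le_trans (sum_mxquad_le Y Qdp).
  rewrite /S mulr_sumr; apply: ler_sum => l _; rewrite QdE -/(u l).
  have := edge l (u l) (pr l); rewrite -/(z l) mxquadD// mxformZr mxquadZ.
  have : d * mxquad X (u l) <= e * mxquad 1%:M (u l).
    apply: le_trans (ler_wpM2l (ltW d0) (cX _ _)) _; rewrite mulrA.
    by apply: ler_wpM2r; [exact: mxquad1_ge0|rewrite -ler_pdivlMr].
  move=> h1 h2; lra.
pose v l := z l *m (b l)^T.
rewrite (eq_bigr (fun i => edge_distribution p i ord0 *
    mxquad X (Ad *m Y + \sum_(l < m) (mode_bit m i l)%:R *: v l))); last first.
  move=> i _; congr (_ * mxquad X (_ + _)); rewrite mulmx_sumr.
  by apply: eq_bigr => l _; rewrite -scalemxAr /v /z /u !mulmxA.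
rewrite mxquad_mean// mxquadD//.
have -> : \sum_l p l *: v l = \sum_l (p l *: z l) *m (b l)^T.
  by apply: eq_bigr => l _; rewrite -scalemxAl.
have := mxquad_sum_outer_le (fun l => p l *: z l) Xp.
rewrite mxform_sumr => h1; move: S_le; rewrite QdE => h2.
(* The squared norm 2 of an incidence vector supplies the factor 2 of the variance terms in [S]. *)
have SE : S = 2 * (\sum_l mxform X (Ad *m Y) ((p l *: z l) *m (b l)^T)) +
    lambda * (\sum_l mxquad X (p l *: z l)) +
    \sum_l p l * (1 - p l) * mxquad X (v l).
  rewrite !mulr_sumr -!big_split; apply: eq_bigr => l _ /=.
  rewrite mxform_outer mxformZr mxquadZ /v mxquad_outer b2 -mulmxA -/(u l).
  by ring.
lra.
Qed.

End Network.

(** * The largest eigenvalue of the Laplacian *)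

Section LargestEigenvalue.
Variables (R : realType) (N : nat) (T : finType) (b : T -> 'cV[R]_N).
Hypothesis b2 : forall t, mxquad 1%:M (b t) = 2.
Let L := \sum_t b t *m (b t)^T.

Lemma mxquad_sum_outer (y : 'cV[R]_N) :
  mxquad L y = \sum_t mxquad 1%:M (y^T *m b t).
Proof.
rewrite /mxquad /mxform /L mulmx_sumr mulmx_suml raddf_sum /=.
apply: eq_bigr => t _.
by rewrite mulmx1 trmx_mul trmxK [RHS]mxtrace_mulC !mulmxA.
Qed.

(** The maximal Rayleigh quotient is an eigenvalue and dominates all others. It is positive because
    the form of [L] is positive at [b t0]. *)
Lemma largest_eigenvalue_bound (t0 : T) :
  exists lambda, [/\ 0 < lambda, largest_nonzero_eigenvalue L lambda &
    forall y : 'cV[R]_N, mxquad L y <= lambda * mxquad 1%:M y].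
Proof.
have Ls : L^T = L.
  by rewrite /L raddf_sum; apply: eq_bigr => t _ /=; rewrite trmx_mul trmxK.
have [c cL c_le] : exists2 c, eigenvalue L c &
    forall y : 'cV[R]_N, mxquad L y <= c * mxquad 1%:M y.
  (* [max_eigenvalue] needs a positive dimension; dimension 0 contradicts [|b t0|^2 = 2]. *)
  move: L Ls; have := b2 t0; case: (N) (b t0) => [|N'] b0.
    by rewrite (flatmx0 b0) mxquad0r => /eqP; rewrite eq_sym pnatr_eq0.
  by move=> _ M Ms; exact: max_eigenvalue.
have c0 : 0 < c.
  have : 0 < mxquad L (b t0).
    rewrite mxquad_sum_outer (bigD1 t0)//= ltr_wpDr//.
      by apply: sumr_ge0 => t _; exact: mxquad1_ge0.
    rewrite lt_def mxquad1_ge0 mxquad1_eq0 andbT.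
    apply: contra_eq_neq (b2 t0) => h.
    by rewrite mxquadE mulmx1 h mxE eq_sym pnatr_eq0.
  by move=> /lt_le_trans/(_ (c_le _)); rewrite b2 pmulr_lgt0.
exists c; split=> //; split=> [|a [/eigenvalueP[v va v0] _]].
  by split=> //; rewrite gt_eqF.
have v1 : 0 < mxquad 1%:M v^T.
  by rewrite lt_def mxquad1_ge0 mxquad1_eq0 trmx_eq0 v0.
rewrite -(ler_pM2r v1); apply: le_trans (c_le _).
by rewrite /mxquad /mxform trmxK va -scalemxAl mxtraceZ mulmx1.
Qed.

End LargestEigenvalue.

(** * Markov jump linear systems *)

Section FiniteExpectation.
Variables (d : measure_display) (T : measurableType d) (R : realType).
Variables (Pr : probability T R) (F : finType) (Y : T -> F).
Hypothesis mY : forall y, measurable [set w | Y w = y].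

Lemma expectation_finite (g : F -> R) :
  ('E_Pr[fun w => g (Y w)] =
   (\sum_y g y * fine (Pr [set w | Y w = y]))%:E)%E.
Proof.
rewrite unlock.
transitivity (\int[Pr]_w (\sum_y (g y)%:E * (\1_[set w | Y w = y] w)%:E))%E.
  apply: eq_integral => w _; rewrite (bigD1 (Y w))//= big1 => [|y yw].
    by rewrite adde0 indicE mem_set// mule1.
  by rewrite indicE memNset ?mule0//= => wy; move: yw; rewrite wy eqxx.
have int_ind y := integrable_indic Pr (mY y).
rewrite integral_sum//; last by move=> y; exact: integrableZl.
rewrite -sumEFin; apply: eq_bigr => y _; rewrite integralZl//.
by rewrite integral_indic// setIT EFinM fineK// fin_num_measure.
Qed.

Lemma sum_probability_fibers : \sum_y fine (Pr [set w | Y w = y]) = 1.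
Proof.
have := expectation_finite (cst 1); rewrite expectation_cst => -[] ->.
by apply: eq_bigr => y _; rewrite mul1r.
Qed.

(** Expanding the nonnegative variance of [g] bounds the squared mean by the mean square. *)
Lemma sqr_mean_le (g q : F -> R) : (forall y, g y ^+ 2 <= q y) ->
  (\sum_y g y * fine (Pr [set w | Y w = y])) ^+ 2 <=
  \sum_y q y * fine (Pr [set w | Y w = y]).
Proof.
move=> gq; set p := fun y => fine (Pr [set w | Y w = y]).
have p0 y : 0 <= p y by rewrite fine_ge0.
set mu := \sum_y _; have muE : mu = \sum_y g y * p y by [].
clearbody mu; apply: le_trans (_ : \sum_y g y ^+ 2 * p y <= _).
  have : 0 <= \sum_y (g y - mu) ^+ 2 * p y.
    by apply: sumr_ge0 => y _; rewrite mulr_ge0// sqr_ge0.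
  have -> : \sum_y (g y - mu) ^+ 2 * p y = \sum_y g y ^+ 2 * p y
      + (- (2 * mu)) * (\sum_y g y * p y) + mu ^+ 2 * \sum_y p y.
    by rewrite !mulr_sumr -!big_split; apply: eq_bigr => y _ /=; ring.
  by rewrite sum_probability_fibers -muE; lra.
by apply: ler_sum => y _; rewrite ler_wpM2r.
Qed.

End FiniteExpectation.

Section MarkovJump.
Variables (d : measure_display) (T : measurableType d) (R : realType).
Variables (Pr : probability T R) (s : nat) (Gamma : 'M[R]_s).
Variable sigma : nat -> T -> 'I_s.
Hypothesis markov : homogeneous_markov_chain Pr Gamma sigma.
Variables (n : nat) (A : 'I_s -> 'M[R]_n) (x0 : 'cV[R]_n).

(** The sample spaces may differ, so that a random trajectory can be compared with a deterministic
    one over [unit]. *)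
Lemma eq_trajectory (S S' : Type) (sg : nat -> S -> 'I_s)
    (sg' : nat -> S' -> 'I_s) k w w' :
  (forall l, (l < k)%N -> sg l w = sg' l w') ->
  trajectory A sg x0 k w = trajectory A sg' x0 k w'.
Proof.
elim: k => [//|k IHk] eq_sg /=; rewrite eq_sg// IHk// => l lk.
by apply: eq_sg; rewrite ltnS ltnW.
Qed.

Definition mode_path k w : {ffun 'I_k.+1 -> 'I_s} :=
  [ffun l => sigma (val l) w].

(** Beyond [k], [inord] falls back to index 0; only the values up to [k] are used. *)
Definition path_fun k (h : {ffun 'I_k.+1 -> 'I_s}) (l : nat) : 'I_s :=
  h (inord l).

Lemma mode_path_history k h :
  [set w | mode_path k w = h] = history sigma k (path_fun h).
Proof.
apply/seteqP; split=> w /= => [<- l lk|hw].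
  by rewrite /path_fun ffunE /= inordK.
apply/ffunP => l; rewrite ffunE hw; last exact: leq_ord.
by rewrite /path_fun inord_val.
Qed.

Lemma measurable_history k (g : nat -> 'I_s) : measurable (history sigma k g).
Proof.
rewrite (_ : history _ _ _ = \bigcap_(l in `I_k.+1) [set w | sigma l w = g l]).
  by apply: bigcap_measurable => [|l _]; [exists 0%N|exact: markov.1].
by apply/seteqP; split=> w hw l lk; apply: hw.
Qed.

Lemma measurable_mode_path k h : measurable [set w | mode_path k w = h].
Proof. by rewrite mode_path_history; exact: measurable_history. Qed.

(** The modes at times 0 to [k] determine the state at time [k.+1]; accordingly [mean_state k] below
    is a mean at time [k.+1]. *)
Definition path_state k (h : {ffun 'I_k.+1 -> 'I_s}) : 'cV[R]_n :=
  trajectory A (fun l (_ : unit) => path_fun h l) x0 k.+1 tt.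

Lemma trajectory_path k w :
  trajectory A sigma x0 k.+1 w = path_state (mode_path k w).
Proof.
by apply: eq_trajectory => l lk; rewrite /path_fun ffunE /= inordK.
Qed.

Definition mean_state k (V : 'cV[R]_n -> R) : R :=
  \sum_h V (path_state h) * fine (Pr [set w | mode_path k w = h]).

Lemma expectation_state k (V : 'cV[R]_n -> R) :
  ('E_Pr[fun w => V (trajectory A sigma x0 k.+1 w)] = (mean_state k V)%:E)%E.
Proof.
rewrite /mean_state.
rewrite -(expectation_finite Pr (@measurable_mode_path k) (V \o @path_state k)).
by congr ('E_Pr[_])%E; apply/funext => w /=; rewrite -trajectory_path.
Qed.

(** The Markov property gives this for histories of positive probability; for null histories both
    sides vanish. *)
Lemma joint_probability k (h : {ffun 'I_k.+1 -> 'I_s}) j :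
  fine (Pr [set w | (mode_path k w, sigma k.+1 w) = (h, j)]) =
  fine (Pr [set w | mode_path k w = h]) * Gamma (h ord_max) j.
Proof.
have -> : [set w | (mode_path k w, sigma k.+1 w) = (h, j)] =
    [set w | sigma k.+1 w = j] `&` history sigma k (path_fun h).
  rewrite -mode_path_history; apply/seteqP.
  split=> w /=; first by move=> [-> ->].
  by move=> [-> ->].
rewrite mode_path_history; have mH := measurable_history k (path_fun h).
have mI := measurableI _ _ (markov.1 k.+1 j) mH.
have [H0|H0] := eqVneq (Pr (history sigma k (path_fun h))) 0%E.
  rewrite H0 mul0r (_ : Pr _ = 0%E)//; apply/eqP.
  by rewrite eq_le measure_ge0 andbT -H0 le_measure ?inE//; exact: subIsetr.
have := markov.2 k (path_fun h) j H0; rewrite /cond_prob.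
have -> : path_fun h k = h ord_max.
  by rewrite /path_fun; congr (h _); apply: val_inj; rewrite /= inordK.
move=> <-; rewrite mulrC divfK// fine_eq0// fin_num_measure//.
Qed.

Lemma mean_stateS k V : mean_state k.+1 V =
  \sum_h fine (Pr [set w | mode_path k w = h]) *
    \sum_j Gamma (h ord_max) j * V (A j *m path_state h).
Proof.
pose Y w := (mode_path k w, sigma k.+1 w).
have mY y : measurable [set w | Y w = y].
  case: y => h j; rewrite (_ : [set w | _] =
    [set w | mode_path k w = h] `&` [set w | sigma k.+1 w = j]).
    by apply: measurableI; [exact: measurable_mode_path|exact: markov.1].
  by apply/seteqP; split=> w /=; [move=> [-> ->]|move=> [<- <-]].
have := expectation_finite Pr mY (fun y => V (A y.2 *m path_state y.1)).
have -> : (fun w => V (A (Y w).2 *m path_state (Y w).1)) =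
    (fun w => V (trajectory A sigma x0 k.+2 w)).
  by apply/funext => w /=; rewrite -trajectory_path.
rewrite expectation_state => -[] ->.
transitivity (\sum_h \sum_j V (A j *m path_state h) *
    fine (Pr [set w | Y w = (h, j)])).
  by rewrite pair_bigA; apply: eq_bigr => -[].
apply: eq_bigr => h _; rewrite mulr_sumr; apply: eq_bigr => j _.
by rewrite joint_probability; ring.
Qed.

Lemma mean_state_geometric V r : 0 <= r ->
  (forall i x, \sum_j Gamma i j * V (A j *m x) <= r * V x) ->
  forall k, mean_state k V <= mean_state 0 V * r ^+ k.
Proof.
move=> r0 Vr; elim=> [|k IHk]; first by rewrite expr0 mulr1.
rewrite exprSr mulrA [leRHS]mulrC; apply: le_trans (ler_wpM2l r0 IHk).
rewrite mean_stateS [X in _ <= r * X]/mean_state mulr_sumr.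
apply: ler_sum => h _.
by rewrite mulrA [leRHS]mulrC ler_wpM2l ?fine_ge0.
Qed.

(** [V] is a Lyapunov function: its mean decays geometrically and dominates the mean square, which
    in turn dominates the squared mean of each coordinate. *)
Lemma mean_square_stability V c r : 0 <= c -> 0 <= r < 1 ->
  (forall x, sqr_norm2 x <= c * V x) ->
  (forall i x, \sum_j Gamma i j * V (A j *m x) <= r * V x) ->
  (forall i : 'I_n,
     ('E_Pr[fun w => trajectory A sigma x0 k w i ord0])%E @[k --> \oo]
       --> 0%E) /\
  ('E_Pr[fun w => sqr_norm2 (trajectory A sigma x0 k w)])%E @[k --> \oo]
    --> 0%E.
Proof.
move=> c0 /andP[r0 r1] nV Vr; pose q k := mean_state k (@sqr_norm2 R n).
have norm0 x : 0 <= sqr_norm2 (x : 'cV[R]_n).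
  by apply: sumr_ge0 => i _; exact: sqr_ge0.
have c_ge k : q k <= c * mean_state k V.
  rewrite mulr_sumr; apply: ler_sum => h _; rewrite mulrA ler_wpM2r ?fine_ge0//.
have q0 : q k @[k --> \oo] --> (0 : R).
  have C0 : geometric (c * mean_state 0 V) r k @[k --> \oo] --> (0 : R).
    by apply: cvg_geometric; rewrite ger0_norm.
  apply: (@squeeze_cvgr _ _ _ _ (cst 0) _ _ _ _ _ C0); last exact: cvg_cst.
  apply: nearW => k; apply/andP; split; last first.
    apply: le_trans (c_ge k) _; rewrite /geometric /= -mulrA ler_wpM2l//.
    exact: mean_state_geometric.
  by apply: sumr_ge0 => h _; rewrite mulr_ge0// fine_ge0.
(* The finite-sum formulas start at time 1, so limits are taken along the shifted sequence. *)
have EFin0 (f : nat -> R) (g : nat -> \bar R) : (forall k, g k.+1 = (f k)%:E) ->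
    f k @[k --> \oo] --> (0 : R) -> g k @[k --> \oo] --> 0%E.
  move=> gf f0; rewrite -cvg_shiftS.
  rewrite (_ : [sequence g k.+1]_k = EFin \o f); last exact/funext.
  by apply: cvg_EFin; [exact: nearW|].
split=> [i|]; last first.
  by apply: (EFin0 q) => // k; rewrite expectation_state.
apply: (EFin0 (fun k => mean_state k (fun x => x i ord0))).
  by move=> k; rewrite (expectation_state k (fun x => x i ord0)).
have sq k : mean_state k (fun x => x i ord0) ^+ 2 <= q k.
  apply: (sqr_mean_le Pr (@measurable_mode_path k)
    (g := fun h => path_state h i ord0)) => h.
  by rewrite /sqr_norm2 (bigD1 i)//= lerDl sumr_ge0// => l _; exact: sqr_ge0.
apply/cvgrPdist_lt => eps eps0.
have /cvgrPdist_lt/(_ (eps ^+ 2)) := q0; rewrite exprn_gt0// => /(_ isT).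
apply: filterS => k; rewrite !sub0r !normrN => qk.
rewrite -(@ltr_pXn2r _ 2) ?nnegrE ?(ltW eps0)// real_normK ?num_real//.
exact: le_lt_trans (sq k) (le_lt_trans (ler_norm _) qk).
Qed.

End MarkovJump.

(** * Stacked states as matrices *)

Section Vectorization.
Variables (R : realType) (N n : nat).

(** Inverse of column stacking: column [i] is the state of vertex [i], and a Kronecker product
    becomes a two-sided multiplication. *)
Definition unvec (x : 'cV[R]_(N * n)) : 'M[R]_(n, N) :=
  \matrix_(a, i) x (mxtens_index (i, a)) ord0.

Lemma sum_mxtens (f : 'I_(N * n) -> R) :
  \sum_k f k = \sum_i \sum_a f (mxtens_index (i, a)).
Proof.
rewrite pair_bigA (reindex (@mxtens_index N n)) /=.
  by apply: eq_bigr => -[].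
by exists (@mxtens_unindex N n) => ? _; rewrite ?mxtens_indexK ?mxtens_unindexK.
Qed.

Lemma unvecD x y : unvec (x + y) = unvec x + unvec y.
Proof. by apply/matrixP => a i; rewrite !mxE. Qed.

Lemma unvec_tens (A : 'M[R]_N) (B : 'M[R]_n) (x : 'cV[R]_(N * n)) :
  unvec ((A *t B) *m x) = B *m unvec x *m A^T.
Proof.
apply/matrixP => a i; rewrite !mxE sum_mxtens; apply: eq_bigr => j _.
rewrite !mxE mulr_suml; apply: eq_bigr => c _.
by rewrite tensmxE !mxE; ring.
Qed.

Lemma sqr_norm2_unvec x : sqr_norm2 x = mxquad 1%:M (unvec x).
Proof.
rewrite /sqr_norm2 sum_mxtens mxquad1E exchange_big /=.
by apply: eq_bigr => a _; apply: eq_bigr => i _; rewrite mxE.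
Qed.

End Vectorization.

(** The bound defines a half-space of matrices, which is convex and therefore contains the hull of
    any set it contains. *)
Lemma conv_hull_row_le (R : realType) s (S : set 'M[R]_s) (i : 'I_s)
    (v : 'I_s -> R) (c : R) :
  (forall G, S G -> \sum_j G i j * v j <= c) ->
  forall G, conv_hull S G -> \sum_j G i j * v j <= c.
Proof.
move=> Sc; apply: smallest_sub Sc => G G' t; rewrite !inE /= => hG hG'.
have -> : \sum_j (conv t G G') i j * v j =
    t%:num * (\sum_j G i j * v j) + (1 - t%:num) * (\sum_j G' i j * v j).
  rewrite !mulr_sumr -big_split; apply: eq_bigr => j _ /=.
  by rewrite /conv /= !mxE /unstable.onem; ring.
have t0 : 0 <= t%:num by [].
have t1 : 0 <= 1 - t%:num by rewrite subr_ge0.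
have := ler_wpM2l t0 hG; have := ler_wpM2l t1 hG'; lra.
Qed.

Theorem theorem3 (R : realType) (N : nat) (hN : (2 <= N)%N)
    (E0 : {set {set 'I_N}}) (hE0 : simple_graph E0)
    (m : nat) (hm : #|E0| = m)
    (nu : edge_of E0 -> 'I_m) (hnu : bijective nu)
    (nx : nat) (Ad Ac : 'M[R]_nx)
    (rl ru : R) (hrl : 0 <= rl) (hr : rl <= ru) (hru : ru <= 1)
    (X : 'M[R]_nx) (hX : posdef X)
    (P : 'M[R]_(5 * nx)) (hP : P^T = P)
    (hmult : forall D, Delta_set rl ru D ->
      posdef ((multiplier_factor nx D)^T *m P *m multiplier_factor nx D))
    (hAd : negdef (Ad^T *m X *m Ad - X))
    (hlambda : forall lambda : R,
      smallest_nonzero_eigenvalue (laplacian R E0) lambda \/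
      largest_nonzero_eigenvalue (laplacian R E0) lambda ->
      negdef ((Psi Ad Ac lambda)^T *m middle_mx X P *m Psi Ad Ac lambda)) :
  robustly_mean_square_stable (mode_matrix nu Ad Ac)
    (conv_hull (vertex_transitions rl ru m)).
Proof.
have [b [b2 bL]] := laplacian_incidence R hE0.
have [nu' nuK nu'K] := hnu.
have sum_nu' (F : 'I_m -> 'M[R]_N) : \sum_l F l = \sum_e F (nu e).
  by rewrite (reindex nu) //=; exists nu' => ? _; rewrite ?nuK ?nu'K.
(* Incidence vectors indexed by edge number, to match the bits of a mode. *)
pose c l := b (nu' l); pose L := \sum_l c l *m (c l)^T.
have c2 l : mxquad 1%:M (c l) = 2 by exact: b2.
have E0E : E0 = [set val e | e in [set: edge_of E0]]%SET.
  apply/setP => s; apply/idP/imsetP => [sE0|[e _ ->]]; last exact: valP.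
  by exists (exist _ s sE0).
have L_E0 : laplacian R E0 = L.
  rewrite (congr1 (@laplacian R N) E0E) bL /L sum_nu'.
  by apply: eq_big => e; rewrite ?inE // /c nuK.
have L_mode i : laplacian R (mode_edges nu i) =
    \sum_(l < m) (mode_bit m i l)%:R *: (c l *m (c l)^T).
  rewrite mode_edges_bit// bL sum_nu' big_mkcond; apply: eq_bigr => e _.
  by rewrite inE /c nuK; case: mode_bit; rewrite ?scale1r ?scale0r.
have [lambda [e [lambda0 e0 L_le edge]]] : exists lambda e : R,
    [/\ 0 < lambda, 0 < e,
      forall y : 'cV[R]_N, mxquad L y <= lambda * mxquad 1%:M y &
      forall (l : 'I_m) (x : 'cV[R]_nx) t, rl <= t <= ru ->
        - mxquad X x + mxquad X (Ad *m x + (lambda * t) *: (Ac *m x)) +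
        2 * (t * (1 - t)) * lambda * mxquad X (Ac *m x) <= - e * mxquad 1%:M x].
  have [l0 _|no_edge] := pickP 'I_m.
    have [lambda [lambda0 largest L_le]] := largest_eigenvalue_bound c2 l0.
    have [|e e0 edge] := @edge_dissipation _ _ Ad Ac X P rl ru hrl hru hmult
        lambda (ltW lambda0).
      by apply: hlambda; right; rewrite L_E0.
    by exists lambda, e; split=> // _; exact: edge.
  (* Without edges [L] is zero and has no non-zero eigenvalue; any positive constants do, since the
     edge inequality ranges over an empty set of [l]. *)
  exists 1, 1; split=> // [y|l]; last by have := no_edge l.
  rewrite /L big_pred0// mul1r /mxquad /mxform mulmx0 mul0mx mxtrace0.
  exact: mxquad1_ge0.
have [d [d0 d1 contraction]] :=
  network_contraction lambda0 L_le c2 hX hAd e0 edge.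
have [k k0 Xk] := posdef_coercive hX.
move=> x0 s0 Gamma GammaIn disp T Pr sigma markov _.
(* The Lyapunov function is the [X]-norm squared of the matrix state; [k^-1] comes from coercivity
   of [X] and [1 - d] from the contraction. *)
apply: (@mean_square_stability _ _ _ _ _ _ _ markov _ _ _
  (fun x => mxquad X (unvec x)) k^-1 (1 - d)).
- by rewrite invr_ge0 ltW.
- by rewrite subr_ge0 ltW//= gtrBl.
- by move=> x; rewrite sqr_norm2_unvec mulrC ler_pdivlMr// mulrC.
move=> i x; pose v j := mxquad X (unvec (mode_matrix nu Ad Ac j *m x)).
(* For a fixed current mode [i] the bound is affine in row [i] alone, so it suffices that this row
   is a product distribution. *)
apply: (conv_hull_row_le (v := v)) GammaIn => G /(_ i)[p pE GE].
have Gp j : G i j = edge_distribution p j ord0 by rewrite -GE !mxE.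
under eq_bigr do rewrite Gp.
have pr l : rl <= p l <= ru by have [_ [->|->]] := pE l; rewrite lexx ?hr.
apply: le_trans (contraction p (unvec x) pr); rewrite le_eqVlt; apply/orP; left.
apply/eqP/eq_bigr => j _; rewrite /v /mode_matrix mulmxDl unvecD !unvec_tens.
rewrite trmx1 mulmx1 L_mode raddf_sum; congr (_ * mxquad X (_ + _ *m _)).
apply: eq_bigr => l _; apply/matrixP => r q.
by rewrite !mxE !big_ord1 !mxE [c l r _ * _]mulrC.
Qed.
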